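(* Let $n\ge1$ and $r,s\in\mathbb{Z}$. If $D_m^{(r)}\ne0$ for $1\le m\le n+1$, then for all $z_1,z_2\in\mathbb{C}$ $$K_n(z_2,z_1;r)=\frac{1}{D_{n+1}^{(r)}}\mathcal{D}_n\big[w(\zeta)\zeta^{-r}(z_1-\zeta)(z_2-\zeta^{-2})\big].$$ If $E_m^{(s)}\ne0$ for $1\le m\le n+1$, then for all $z_1,z_2\in\mathbb{C}$ $$L_n(z_2,z_1;s)=\frac{1}{E_{n+1}^{(s)}}\mathcal{E}_n\big[w(\zeta)\zeta^{-s}(z_1-\zeta^2)(z_2-\zeta^{-1})\big],$$ and, if in addition $D_m^{(s-n)}\neq0$ for $1\le m\le n+1$ and $z_1,z_2\ne0$, this also equals $$(z_1z_2)^nK_n(z_1^{-1},z_2^{-1};s-n).$$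
   Context: $\mathbb{T}$ is the unit circle, oriented counterclockwise; $w$ is a complex-valued integrable weight on $\mathbb{T}$ with Fourier coefficients $w_k=\int_{\mathbb{T}}\zeta^{-k}w(\zeta)\frac{d\zeta}{2\pi i\zeta}$. For $n\ge1$, $D_n^{(r)}=\det(w_{r+2j-k})_{0\le j,k\le n-1}$, $E_n^{(s)}=\det(w_{s+j-2k})_{0\le j,k\le n-1}$ ($j$ row index, $k$ column index), $D_0^{(r)}=E_0^{(s)}=1$. For an integrable function $f$ on $\mathbb{T}$, $$\mathcal{D}_n[f(\zeta)]=\frac1{n!}\int_{\mathbb{T}}\frac{d\zeta_1}{2\pi i\zeta_1}\cdots\int_{\mathbb{T}}\frac{d\zeta_n}{2\pi i\zeta_n}\prod_{j=1}^nf(\zeta_j)\prod_{1\le j<k\le n}(\zeta_k-\zeta_j)(\zeta_k^{-2}-\zeta_j^{-2}),$$ $$\mathcal{E}_n[f(\zeta)]=\frac1{n!}\int_{\mathbb{T}}\frac{d\zeta_1}{2\pi i\zeta_1}\cdots\int_{\mathbb{T}}\frac{d\zeta_n}{2\pi i\zeta_n}\prod_{j=1}^nf(\zeta_j)\prod_{1\le j<k\le n}(\zeta_k^2-\zeta_j^2)(\zeta_k^{-1}-\zeta_j^{-1}).$$ When $D_n^{(r)}\ne0$, $P_n(z;r)$ and $Q_n(z;r)$ are the unique monic polynomials of degree $n$ with $\int_{\mathbb{T}}P_n(\zeta;r)\zeta^{-2m-r}w(\zeta)\frac{d\zeta}{2\pi i\zeta}=0$ and $\int_{\mathbb{T}}Q_n(\zeta^{-2};r)\zeta^{m-r}w(\zeta)\frac{d\zeta}{2\pi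 i\zeta}=0$ for $0\le m\le n-1$; for $m=n$ both integrals equal $h_n^{(r)}=D_{n+1}^{(r)}/D_n^{(r)}$. When $E_n^{(s)}\ne0$, $R_n(z;s)$ and $S_n(z;s)$ are the unique monic polynomials of degree $n$ with $\int_{\mathbb{T}}R_n(\zeta^2;s)\zeta^{-m-s}w(\zeta)\frac{d\zeta}{2\pi i\zeta}=0$ and $\int_{\mathbb{T}}S_n(\zeta^{-1};s)\zeta^{2m-s}w(\zeta)\frac{d\zeta}{2\pi i\zeta}=0$ for $0\le m\le n-1$; for $m=n$ both integrals equal $g_n^{(s)}=E_{n+1}^{(s)}/E_n^{(s)}$. Reproducing kernels: $K_n(z,y;r)=\sum_{j=0}^n\frac{1}{h_j^{(r)}}Q_j(z;r)P_j(y;r)$ and $L_n(z,y;s)=\sum_{j=0}^n\frac{1}{g_j^{(s)}}S_j(z;s)R_j(y;s)$. *)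

(* Defs.v *)
From HB Require Import structures.
From mathcomp Require Import all_boot all_order all_algebra.
From mathcomp Require Import all_classical all_reals all_analysis.
From mathcomp Require Import complex.

Set Implicit Arguments.
Unset Strict Implicit.
Unset Printing Implicit Defensive.

Import Order.TTheory GRing.Theory Num.Theory.

Local Open Scope classical_set_scope.
Local Open Scope ring_scope.
Local Open Scope complex_scope.

Section CircleIntegral.
Variable R : realType.
Local Notation C := R[i].

Definition expi (t : R) : C := cos t +i* sin t.

(* Functions on the unit circle are functions C -> C of which only the
   values at the points expi t matter. *)
Definition circle_integrable (f : C -> C) : Prop :=
  (@lebesgue_measure R).-integrable `[0, 2 * pi]
    (EFin \o (fun t => complex.Re (f (expi t)))) /\
  (@lebesgue_measure R).-integrable `[0, 2 * pi]
    (EFin \o (fun t => complex.Im (f (expi t)))).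

(* With zeta = expi t one has d zeta / (2 pi i zeta) = dt / (2 pi), so this is
   the integral of f over the unit circle against d zeta / (2 pi i zeta). *)
Definition circle_integral (f : C -> C) : C :=
  ((2 * pi)^-1)%:C *
  ((\int[@lebesgue_measure R]_(t in `[0, 2 * pi]) complex.Re (f (expi t)))%R +i*
   (\int[@lebesgue_measure R]_(t in `[0, 2 * pi]) complex.Im (f (expi t)))%R).

(* The outermost integral is over the first component. *)
Fixpoint circle_integral_n (n : nat) : (n.-tuple C -> C) -> C :=
  match n with
  | 0 => fun F => F [tuple]
  | m.+1 => fun F =>
      circle_integral (fun z => circle_integral_n (fun t => F [tuple of z :: t]))
  end.

Definition calD (n : nat) (f : C -> C) : C :=
  (n`!%:R)^-1 * circle_integral_n (fun z : n.-tuple C =>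
    (\prod_(j < n) f (tnth z j)) *
    \prod_(j < n) \prod_(k < n | (j < k)%N)
      ((tnth z k - tnth z j) * (tnth z k ^- 2 - tnth z j ^- 2))).

Definition calE (n : nat) (f : C -> C) : C :=
  (n`!%:R)^-1 * circle_integral_n (fun z : n.-tuple C =>
    (\prod_(j < n) f (tnth z j)) *
    \prod_(j < n) \prod_(k < n | (j < k)%N)
      ((tnth z k ^+ 2 - tnth z j ^+ 2) * ((tnth z k)^-1 - (tnth z j)^-1))).

End CircleIntegral.

Section Weight.
Variables (R : realType) (w : R[i] -> R[i]).
Local Notation C := R[i].
Implicit Types (n : nat) (r s : int) (p : {poly C}).

Definition fourier (k : int) : C := circle_integral (fun z => z ^ (- k) * w z).

Definition detD n r : C :=
  \det (\matrix_(j < n, k < n) fourier (r + 2 * j%:Z - k%:Z)).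

Definition detE n s : C :=
  \det (\matrix_(j < n, k < n) fourier (s + j%:Z - 2 * k%:Z)).

Definition monic_deg n p : Prop := p \is monic /\ size p = n.+1.

Definition is_P n r p : Prop := monic_deg n p /\
  forall m : nat, (m < n)%N ->
    circle_integral (fun z => p.[z] * z ^ (- (2 * m%:Z) - r) * w z) = 0.

Definition is_Q n r p : Prop := monic_deg n p /\
  forall m : nat, (m < n)%N ->
    circle_integral (fun z => p.[z ^- 2] * z ^ (m%:Z - r) * w z) = 0.

Definition is_R n s p : Prop := monic_deg n p /\
  forall m : nat, (m < n)%N ->
    circle_integral (fun z => p.[z ^+ 2] * z ^ (- m%:Z - s) * w z) = 0.

Definition is_S n s p : Prop := monic_deg n p /\
  forall m : nat, (m < n)%N ->
    circle_integral (fun z => p.[z^-1] * z ^ (2 * m%:Z - s) * w z) = 0.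

(* is_P n r and is_Q n r (resp. is_R n s and is_S n s) each have exactly one
   solution when w is integrable and detD n r != 0 (resp. detE n s != 0);
   polyP, polyQ, polyR, polyS denote it. *)
Definition polyP n r : {poly C} := xget 0 [set p | is_P n r p].
Definition polyQ n r : {poly C} := xget 0 [set p | is_Q n r p].
Definition polyR n s : {poly C} := xget 0 [set p | is_R n s p].
Definition polyS n s : {poly C} := xget 0 [set p | is_S n s p].

Definition normh n r : C := detD n.+1 r / detD n r.
Definition normg n s : C := detE n.+1 s / detE n s.

Definition kerK n (z y : C) r : C :=
  \sum_(j < n.+1) (normh j r)^-1 * (polyQ j r).[z] * (polyP j r).[y].

Definition kerL n (z y : C) s : C :=
  \sum_(j < n.+1) (normg j s)^-1 * (polyS j s).[z] * (polyR j s).[y].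

End Weight.

(* Main.v *)
Require Import Defs.
From mathcomp Require Import all_boot all_order all_algebra perm.
From mathcomp Require Import all_classical all_reals all_analysis.
From mathcomp Require Import measurable_realfun complex ring.

(* Both families are biorthogonal systems for a moment matrix
   M_jk = int v alpha^j beta^k, with (alpha, beta, v) = (z^-2, z, w z^-r)
   for D and (z^-1, z^2, w z^-s) for E.  The kernel is the generating function
   sum_jk y^j x^k (M^-1)_kj of the inverse of the (n+1) x (n+1) moment matrix.
   By Andreief's identity the multiple integral is n! times the n x n moment
   determinant of the weight v (x - beta)(y - alpha), and this is
   det M times the same generating function.  The last identity
   holds because reversing rows and columns turns the E moment matrix with
   parameter s into the transpose of the D one with parameter s - n. *)

Set Implicit Arguments.
Unset Strict Implicit.
Unset Printing Implicit Defensive.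

Import Order.TTheory GRing.Theory Num.Theory.

Local Open Scope ring_scope.

(** * Biorthogonal polynomials and the inverse of a moment matrix, over any field *)

Section BiorthogonalSystems.
Variable F : fieldType.
Implicit Types (M : nat -> nat -> F) (p : {poly F}) (P Q : nat -> {poly F}).

(** Moments are an infinite array, so that all leading blocks and shifted entries such as
    [M j.+1 k.+1] come from one [M]. *)
Definition moment_mx M n : 'M[F]_n := \matrix_(j < n, k < n) M j k.

(** For M_jk = int v alpha^j beta^k, the sum in condition [m] is int v alpha^m p(beta). *)
Definition monic_orth M n p : Prop :=
  (p \is monic /\ size p = n.+1) /\
  forall m, (m < n)%N -> \sum_(k < n.+1) p`_k * M m k = 0.

(** With leading coefficient 1 fixed, the [n] lower coefficients [c] solve a square linear system:
    the leading block of [M] applied to [c] must cancel column [n] of [M]. *)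
Lemma monic_orth_exists M n :
  \det (moment_mx M n) != 0 -> exists p, monic_orth M n p.
Proof.
move=> Mn0; have Mu : (moment_mx M n)^T \in unitmx.
  by rewrite unitmx_tr unitmxE unitfE.
pose c := - (\row_(m < n) M m n) *m invmx (moment_mx M n)^T.
have cP (m : 'I_n) : \sum_(k < n) c 0 k * M m k = - M m n.
  have : (c *m (moment_mx M n)^T) 0 m = - M m n.
    by rewrite /c mulNmx mulNmx mulmxKV // !mxE.
  by rewrite mxE => <-; apply: eq_bigr => k _; rewrite !mxE.
have cs : (size (rVpoly c) < size ('X^n : {poly F}))%N.
  by rewrite size_polyXn ltnS size_poly.
exists ('X^n + rVpoly c); split.
  by rewrite monicE lead_coefDl // lead_coefXn size_polyDl // size_polyXn.
move=> m mn; rewrite big_ord_recr /= coefD coefXn eqxx nth_default; last first.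
  exact: size_poly.
rewrite addr0 mul1r -[X in _ + X]opprK -(cP (Ordinal mn)) /=; apply/eqP.
rewrite subr_eq0; apply/eqP/eq_bigr => k _.
by rewrite coefD coefXn ltn_eqF // add0r coef_rVpoly_ord.
Qed.

(** Coefficients beyond the degree vanish, so orthogonality survives in sums of any common length
    [N], as occur in matrix products. *)
Lemma monic_orth_widen M n p N m : monic_orth M n p -> (n < N)%N -> (m < n)%N ->
  \sum_(k < N) p`_k * M m k = 0.
Proof.
move=> [[_ ps] po] nN mn; rewrite -[RHS](po m mn).
rewrite [RHS](big_ord_widen _ (fun k => p`_k * M m k) nN) [RHS]big_mkcond.
apply: eq_bigr => k _; case: ltnP => // nk.
by rewrite nth_default ?mul0r // ps.
Qed.

Definition coef_mx P n : 'M[F]_n := \matrix_(i < n, j < n) (P i)`_j.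

Lemma det_coef_mx P n :
  (forall i, (i < n)%N -> P i \is monic /\ size (P i) = i.+1) ->
  \det (coef_mx P n) = 1.
Proof.
move=> PE; rewrite det_trig; last first.
  apply/is_trig_mxP => i j ij; rewrite mxE nth_default //.
  by have [_ ->] := PE i (ltn_ord i).
rewrite big1 // => i _; rewrite mxE.
by have [/monicP Pm Ps] := PE i (ltn_ord i); rewrite -Pm lead_coefE Ps.
Qed.

Let tr M : nat -> nat -> F := fun j k => M k j.

(** At entry (i, l) with i < l, Q_i only involves rows j <= i of [M], and P_l is orthogonal to
    these; the case l < i is symmetric. On the diagonal only row l survives, with the leading
    coefficient 1 of Q_l. *)
Lemma coef_mx_diag M P Q n :
  (forall i, (i < n)%N -> monic_orth M i (P i)) ->
  (forall i, (i < n)%N -> monic_orth (tr M) i (Q i)) ->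
  coef_mx Q n *m moment_mx M n *m (coef_mx P n)^T =
  diag_mx (\row_(i < n) \sum_(k < i.+1) (P i)`_k * M i k).
Proof.
move=> Po Qo; apply/matrixP => i l; rewrite !mxE.
have [il|li|il] := ltngtP i l.
- rewrite (_ : i == l = false) ?mulr0n; last first.
    by apply/negbTE; rewrite -val_eqE ltn_eqF.
  under eq_bigr => k _ do rewrite !mxE mulr_suml.
  rewrite exchange_big big1 //= => j _.
  have [ji|ij] := leqP j i.
    under eq_bigr => k _ do rewrite !mxE -mulrA [M _ _ * _]mulrC.
    rewrite -mulr_sumr (monic_orth_widen (Po l (ltn_ord l))) ?mulr0 //.
    exact: leq_ltn_trans il.
  rewrite big1 // => k _; rewrite mxE nth_default ?mul0r //.
  by have [[_ ->]] := Qo i (ltn_ord i).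
- rewrite (_ : i == l = false) ?mulr0n; last first.
    by apply/negbTE; rewrite -val_eqE gtn_eqF.
  rewrite big1 // => k _; have [kl|lk] := leqP k l; last first.
    by rewrite [_^T _ _]mxE [coef_mx _ _ _ _]mxE nth_default ?mulr0 //;
      have [[_ ->]] := Po l (ltn_ord l).
  rewrite !mxE; under eq_bigr => j _ do rewrite !mxE.
  rewrite (monic_orth_widen (M := tr M) (Qo i (ltn_ord i))) ?mul0r //.
  exact: leq_ltn_trans li.
- rewrite (ord_inj il) eqxx mulr1n.
  under eq_bigr => k _ do rewrite !mxE mulr_suml.
  rewrite exchange_big (bigD1 l) //= [X in _ + X]big1 ?addr0 => [|j jl].
    have [[/monicP Qm Qs] _] := Qo l (ltn_ord l).
    have Ql : (Q l)`_l = 1 by rewrite -Qm lead_coefE Qs.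
    rewrite [RHS](big_ord_widen _ (fun k => (P l)`_k * M l k) (ltn_ord l)).
    rewrite [RHS]big_mkcond; apply: eq_bigr => k _.
    rewrite !mxE Ql mul1r; case: ltnP => [_|lk]; first exact: mulrC.
    by rewrite nth_default ?mulr0 //; have [[_ ->]] := Po l (ltn_ord l).
  have [jlt|lj] := ltnP j l.
    under eq_bigr => k _ do rewrite !mxE -mulrA [M _ _ * _]mulrC.
    by rewrite -mulr_sumr (monic_orth_widen (Po l (ltn_ord l))) ?mulr0.
  rewrite big1 // => k _; rewrite mxE nth_default ?mul0r //.
  have [[_ ->] _] := Qo l (ltn_ord l).
  by rewrite ltn_neqAle lj andbT eq_sym val_eqE.
Qed.

(* With A, B the unitriangular coefficient matrices of Q, P and h the diagonal
   of norms, A M B^T = h, so M^-1 = B^T h^-1 A has generating function the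
   kernel; taking determinants of the leading blocks identifies h_i. *)
Lemma biorth_kernel M P Q n (z y : F) :
  (forall m, (m <= n)%N -> \det (moment_mx M m) != 0) ->
  (forall i, (i < n)%N -> monic_orth M i (P i)) ->
  (forall i, (i < n)%N -> monic_orth (tr M) i (Q i)) ->
  \sum_(i < n) (\det (moment_mx M i.+1) / \det (moment_mx M i))^-1
               * (Q i).[z] * (P i).[y] =
  \sum_(j < n) \sum_(k < n) z ^+ j * y ^+ k * invmx (moment_mx M n) k j.
Proof.
move=> M0 Po Qo.
pose d i := \sum_(k < i.+1) (P i)`_k * M i k.
have detM m : (m <= n)%N -> \det (moment_mx M m) = \prod_(i < m) d i.
  move=> mn.
  have Pm i : (i < m)%N -> monic_orth M i (P i).
    by move=> im; apply/Po/(leq_trans im).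
  have Qm i : (i < m)%N -> monic_orth (tr M) i (Q i).
    by move=> im; apply/Qo/(leq_trans im).
  have := congr1 determinant (coef_mx_diag Pm Qm).
  rewrite !det_mulmx det_tr !det_coef_mx ?mul1r ?mulr1 ?det_diag; first last.
  - by move=> i /Qm[].
  - by move=> i /Pm[].
  by move=> ->; apply: eq_bigr => i _; rewrite mxE.
have dE (i : 'I_n) : \det (moment_mx M i.+1) / \det (moment_mx M i) = d i.
  rewrite detM // detM 1?ltnW // big_ord_recr /= mulrC mulKf //.
  by rewrite -detM 1?ltnW // M0 // ltnW.
have d0 (i : 'I_n) : d i != 0.
  by rewrite -dE mulf_neq0 ?invr_eq0 ?M0 // ltnW.
pose D' : 'M[F]_n := diag_mx (\row_(i < n) (d i)^-1).
have invE : invmx (moment_mx M n) = (coef_mx P n)^T *m D' *m coef_mx Q n.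
  have Mu : moment_mx M n \in unitmx by rewrite unitmxE unitfE M0.
  have e : (coef_mx P n)^T *m (D' *m coef_mx Q n *m moment_mx M n) = 1%:M.
    (* A one-sided inverse of a square matrix is two-sided, so the factor from [P] may move to the
       right, where the diagonal product is known. *)
    apply: mulmx1C; rewrite -!mulmxA [X in D' *m X]mulmxA coef_mx_diag //.
    rewrite mulmx_diag -diag_const_mx; congr diag_mx.
    by apply/rowP => i; rewrite !mxE mulVf // d0.
  by rewrite -[LHS]mul1mx -e !mulmxA mulmxK.
have hornerE' p (m : 'I_n) x : size p = m.+1 ->
    p.[x] = \sum_(j < n) p`_j * x ^+ j.
  move=> ps; rewrite horner_coef ps.
  rewrite (big_ord_widen _ (fun k => p`_k * x ^+ k) (ltn_ord m)) big_mkcond.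
  apply: eq_bigr => k _; case: ltnP => // mk.
  by rewrite nth_default ?mul0r // ps.
transitivity (\sum_(i < n) \sum_(j < n) \sum_(k < n)
    z ^+ j * y ^+ k * ((P i)`_k * (d i)^-1 * (Q i)`_j)).
  apply: eq_bigr => i _; rewrite dE.
  have [[_ Ps] _] := Po i (ltn_ord i); have [[_ Qs] _] := Qo i (ltn_ord i).
  rewrite (hornerE' (Q i) i) // (hornerE' (P i) i) //.
  rewrite -mulrA big_distrlr mulr_sumr /=.
  apply: eq_bigr => j _; rewrite mulr_sumr; apply: eq_bigr => k _; ring.
rewrite exchange_big; apply: eq_bigr => j _; rewrite exchange_big.
apply: eq_bigr => k _; rewrite -mulr_sumr; congr (_ * _).
rewrite invE mul_mx_diag mxE; apply: eq_bigr => i _; rewrite !mxE; ring.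
Qed.

(* The rows below the first annihilate the geometric vector (z^j)_j. *)
Definition shift_mx n (z : F) : 'M[F]_n.+1 :=
  \matrix_(i < n.+1, j < n.+1)
    (if i == 0 :> nat then (j == 0 :> nat)%:R
     else z * (j == i.-1 :> nat)%:R - (j == i :> nat)%:R).

Lemma shift_mx_sum n z (i : 'I_n) (f : nat -> F) :
  \sum_(j < n.+1) shift_mx n z (lift ord0 i) j * f j = z * f i - f i.+1.
Proof.
under eq_bigr => j _ do rewrite mxE /= mulrBl.
rewrite sumrB; congr (_ - _).
  rewrite (bigD1 (widen_ord (leqnSn n) i)) //= eqxx mulr1 big1 ?addr0 // => j.
  by rewrite -val_eqE /= => /negbTE ->; rewrite mulr0 mul0r.
rewrite (bigD1 (lift ord0 i)) //= eqxx mul1r big1 ?addr0 // => j.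
by rewrite -val_eqE /= => /negbTE ->; rewrite mul0r.
Qed.

Lemma shift_mx_expr n z :
  shift_mx n z *m (\col_(j < n.+1) z ^+ j) = delta_mx ord0 ord0.
Proof.
apply/colP => i; rewrite !mxE; have [k ->|->] := unliftP ord0 i.
  under eq_bigr => j _ do rewrite [(\col_j _) _ _]mxE.
  by rewrite (shift_mx_sum _ _ (fun j => z ^+ j)) exprS subrr.
under eq_bigr => j _ do rewrite !mxE /=.
by rewrite big_ord_recl /= big1 ?addr0 ?mulr1 //= => j _; rewrite mul0r.
Qed.

(** The matrix is lower triangular with diagonal 1, -1, ..., -1, hence invertible for every [z],
    zero included. *)
Lemma det_shift_mx n z : \det (shift_mx n z) = (-1) ^+ n.
Proof.
rewrite det_trig; last first.
  apply/is_trig_mxP => i j ij; rewrite mxE.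
  case: eqP => [i0|_]; first by rewrite gtn_eqF // -i0.
  by rewrite !gtn_eqF ?mulr0 ?subr0 // (leq_ltn_trans (leq_pred _)).
rewrite big_ord_recl mxE /= mul1r (eq_bigr (fun=> -1)) ?prodr_const ?card_ord //.
by move=> i _; rewrite mxE /= eqxx gtn_eqF // mulr0 add0r.
Qed.

(* The left-hand matrix is the minor of T = shift_mx z * M * (shift_mx y)^T
   complementary to its (0,0) entry, so its determinant is
   det M * (T^-1)_00, and both shift matrices map geometric vectors to e_0. *)
Lemma det_shift_moment M n z y : \det (moment_mx M n.+1) != 0 ->
  \det (\matrix_(j < n, k < n)
     (z * (y * M j k - M j k.+1) - (y * M j.+1 k - M j.+1 k.+1))) =
  \det (moment_mx M n.+1) *
  \sum_(j < n.+1) \sum_(k < n.+1)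
     z ^+ j * y ^+ k * invmx (moment_mx M n.+1) k j.
Proof.
set A := moment_mx M n.+1 => A0.
have Au : A \in unitmx by rewrite unitmxE unitfE.
have Su x : shift_mx n x \in unitmx.
  by rewrite unitmxE det_shift_mx unitrX // unitrN1.
pose T := shift_mx n z *m A *m (shift_mx n y)^T.
have Tu : T \in unitmx by rewrite !unitmx_mul unitmx_tr !Su Au.
have detT : \det T = \det A.
  by rewrite !det_mulmx det_tr !det_shift_mx mulrC mulrA -expr2 sqrr_sign mul1r.
pose u := \col_(j < n.+1) z ^+ j; pose v := \col_(k < n.+1) y ^+ k.
transitivity (cofactor T ord0 ord0).
  rewrite /cofactor expr0 mul1r; congr determinant; apply/matrixP => j k.
  rewrite mxE [RHS]mxE [RHS]mxE [RHS]mxE.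
  under eq_bigr => l _ do rewrite [_^T _ _]mxE mulrC.
  transitivity (\sum_l shift_mx n y (lift ord0 k) l *
      (z * M j l - M j.+1 l)).
    by rewrite (shift_mx_sum _ _ (fun l => z * M j l - M j.+1 l)); ring.
  apply: eq_bigr => l _; congr (_ * _).
  rewrite -(shift_mx_sum z j (fun i => M i l)).
  by rewrite mxE; apply: eq_bigr => i _; rewrite [A _ _]mxE.
transitivity (\det A * (invmx T) ord0 ord0).
  by rewrite /invmx Tu !mxE detT mulrA divff // mul1r.
congr (_ * _).
(* The generating function is the bilinear form of the inverse matrix at the two geometric
   vectors. *)
have -> : \sum_(j < n.+1) \sum_(k < n.+1) z ^+ j * y ^+ k * invmx A k j =
    (v^T *m invmx A *m u) 0 0.
  rewrite mxE; apply: eq_bigr => j _; rewrite !mxE mulr_suml.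
  by apply: eq_bigr => k _; rewrite !mxE; ring.
have -> : invmx A = (shift_mx n y)^T *m invmx T *m shift_mx n z.
  apply: (can_inj (mulKmx Au)); rewrite mulmxV //.
  apply: (can_inj (mulKmx (Su z))); rewrite mulmx1.
  by rewrite !mulmxA -/T mulmxV // mul1mx.
rewrite !mulmxA -trmx_mul -!mulmxA !shift_mx_expr !mulmxA trmx_delta -rowE -colE.
by rewrite !mxE.
Qed.

(** With J the reversal matrix, the hypothesis on the blocks is M = J M'^T J, and J^2 = 1 gives M^-1
    = J (M'^-1)^T J; [B] below is this candidate. *)
Lemma invmx_moment_rev (M M' : nat -> nat -> F) n :
  (forall j k, (j <= n)%N -> (k <= n)%N -> M j k = M' (n - k)%N (n - j)%N) ->
  \det (moment_mx M' n.+1) != 0 ->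
  forall j k, invmx (moment_mx M n.+1) j k =
              invmx (moment_mx M' n.+1) (rev_ord k) (rev_ord j).
Proof.
move=> MM' M'0 j k.
have M'u : moment_mx M' n.+1 \in unitmx by rewrite unitmxE unitfE.
pose B : 'M[F]_n.+1 :=
  \matrix_(i, l) invmx (moment_mx M' n.+1) (rev_ord l) (rev_ord i).
have BM : B *m moment_mx M n.+1 = 1%:M.
  apply/matrixP => i l; rewrite mxE.
  transitivity ((moment_mx M' n.+1 *m invmx (moment_mx M' n.+1))
                  (rev_ord l) (rev_ord i)).
    rewrite mxE (reindex_inj rev_ord_inj); apply: eq_bigr => m _.
    rewrite [B _ _]mxE [moment_mx M' _ _ _]mxE [moment_mx M _ _ _]mxE.
    rewrite rev_ordK mulrC; congr (_ * _).
    rewrite (MM' (rev_ord m) l (leq_ord _) (leq_ord _)) /= subSS.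
    by rewrite subKn // leq_ord.
  by rewrite mulmxV // !mxE (inj_eq rev_ord_inj) eq_sym.
(* The left inverse [B] also yields the invertibility of the block of [M]. *)
have [_ Mu] := mulmx1_unit BM.
by rewrite -[invmx _]mul1mx -BM mulmxK // mxE.
Qed.

(** * Products of two Vandermonde determinants as sums over pairs of permutations *)

(** Each Vandermonde determinant is expanded by the Leibniz formula. In every resulting term the
    variables are separated, so it can be integrated one variable at a time. *)
Lemma Vandermonde_prod2 n (a b : 'I_n -> F) :
  \prod_(j < n) \prod_(k < n | (j < k)%N) ((a k - a j) * (b k - b j)) =
  \sum_(st : 'S_n * 'S_n) (-1) ^+ st.1 * (-1) ^+ st.2 *
     \prod_(i < n) (a i ^+ st.1 i * b i ^+ st.2 i).
Proof.
have V (c : 'I_n -> F) : \prod_(j < n) \prod_(k < n | (j < k)%N) (c k - c j) =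
    \sum_(s : 'S_n) (-1) ^+ s * \prod_(i < n) c i ^+ s i.
  transitivity (\det (Vandermonde n (\row_i c i))).
    rewrite det_Vandermonde; apply: eq_bigr => j _; apply: eq_bigr => k _.
    by rewrite !mxE.
  rewrite -det_tr; apply: eq_bigr => s _; congr (_ * _).
  by apply: eq_bigr => i _; rewrite !mxE.
under eq_bigr => j _ do rewrite big_split.
rewrite big_split /= !V big_distrlr pair_bigA; apply: eq_bigr => st _ /=.
by rewrite big_split /= mulrACA.
Qed.

(** For each fixed first permutation s, the sum over the second is sgn(s) times the determinant of
    the row-permuted [A], that is [\det A]; there are n! choices of s. *)
Lemma sum_perm2_det n (A : 'M[F]_n) :
  \sum_(st : 'S_n * 'S_n) (-1) ^+ st.1 * (-1) ^+ st.2 *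
     \prod_(i < n) A (st.1 i) (st.2 i) = n`!%:R * \det A.
Proof.
rewrite -(pair_bigA _ (fun s t : 'S_n => (-1) ^+ s * (-1) ^+ t *
   \prod_(i < n) A (s i) (t i))) /=.
rewrite (eq_bigr (fun=> \det A)) ?sumr_const; last first.
  move=> s _; transitivity ((-1) ^+ s * \det (row_perm s A)).
    rewrite mulr_sumr; apply: eq_bigr => t _; rewrite mulrA; congr (_ * _).
    by apply: eq_bigr => i _; rewrite mxE.
  by rewrite row_permE det_mulmx det_perm mulrA -expr2 sqrr_sign mul1r.
by rewrite card_Sn mulr_natl.
Qed.

End BiorthogonalSystems.

(** * Integrability and linearity of integrals over the unit circle *)

Section CircleIntegralTheory.
Local Open Scope classical_set_scope.
Local Open Scope ring_scope.
Local Open Scope complex_scope.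
Variable R : realType.
Local Notation C := R[i].
Local Notation I := (@circle_integral R).
Local Notation mu := (@lebesgue_measure R).
Local Notation J := ([set` `[0, (2 * pi)%R]] : set (measurableTypeR R)).
Implicit Types f g : C -> C.

(** Agreement on the circle suffices, which makes available the identities between integer powers
    that require a nonzero base. *)
Lemma eq_circle_integrable f g : (forall t, f (expi t) = g (expi t)) ->
  circle_integrable f -> circle_integrable g.
Proof.
move=> fg [fr fi]; split.
  by apply: eq_integrable fr => // t _ /=; rewrite fg.
by apply: eq_integrable fi => // t _ /=; rewrite fg.
Qed.

Lemma eq_circle_integral f g : (forall t, f (expi t) = g (expi t)) -> I f = I g.
Proof.
by move=> fg; rewrite /circle_integral; congr (_ * (_ +i* _));
  apply: eq_Rintegral => t _; rewrite fg.
Qed.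

Let mJ : measurable J. Proof. exact: measurable_itv. Qed.

Let integrable_bounded_mul (a u : R -> R) :
  measurable_fun J a -> [bounded a x | x in J] ->
  mu.-integrable J (EFin \o u) ->
  mu.-integrable J (EFin \o (fun t => a t * u t)).
Proof. by move=> ma ba ui; apply: eq_integrable (integrableMr mJ ma ba ui). Qed.

Let bounded1 (h : R -> R) : (forall t, `|h t| <= 1) -> [bounded h x | x in J].
Proof.
move=> hb; exists 1; split; first exact: real1.
by move=> x x1 y _ /=; rewrite (le_trans (hb y)) // ltW.
Qed.

Let bounded_cst (a : R) : [bounded a | x in J].
Proof.
exists `|a|; split; first exact: num_real.
by move=> x x1 y _ /=; rewrite ltW.
Qed.

Let mcos : measurable_fun J (@cos R).
Proof.
by apply: measurable_funTS; apply: continuous_measurable_fun; exact: continuous_cos.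
Qed.
Let msin : measurable_fun J (@sin R).
Proof.
by apply: measurable_funTS; apply: continuous_measurable_fun; exact: continuous_sin.
Qed.

(** The real and imaginary parts of the product are combinations of bounded measurable functions
    times integrable ones. *)
Lemma circle_integrable_mul (c f : C -> C) :
  measurable_fun J (fun t => complex.Re (c (expi t))) ->
  [bounded complex.Re (c (expi t)) | t in J] ->
  measurable_fun J (fun t => complex.Im (c (expi t))) ->
  [bounded complex.Im (c (expi t)) | t in J] ->
  circle_integrable f -> circle_integrable (fun z => c z * f z).
Proof.
move=> mr br mi bi [fr fi]; split.
  have := integrableB mJ (integrable_bounded_mul mr br fr)
                         (integrable_bounded_mul mi bi fi).
  apply: eq_integrable => // t _ /=.
  by case: (c _) (f _) => a b [u v] /=.
have := integrableD mJ (integrable_bounded_mul mr br fi)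
                       (integrable_bounded_mul mi bi fr).
apply: eq_integrable => // t _ /=.
by case: (c _) (f _) => a b [u v] /=; congr EFin; ring.
Qed.

Lemma circle_integrableZ (c : C) f :
  circle_integrable f -> circle_integrable (fun z => c * f z).
Proof.
by apply: (circle_integrable_mul (c := fun=> c)) => //; exact: bounded_cst.
Qed.

Lemma expi_neq0 (t : R) : expi t != 0.
Proof.
apply/eqP => -[c0 s0]; have := cos2Dsin2 t.
by rewrite c0 s0 expr0n addr0 => /esym/eqP; rewrite oner_eq0.
Qed.

Lemma expiV (t : R) : (expi t)^-1 = cos t -i* sin t.
Proof.
apply: (mulfI (expi_neq0 t)); rewrite divff ?expi_neq0 //.
apply/eqP; rewrite eq_complex /= mulrN opprK -!expr2 cos2Dsin2 eqxx /=.
by rewrite mulrN [sin t * _]mulrC addNr.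
Qed.

Lemma circle_integrable_exprz (k : int) f :
  circle_integrable f -> circle_integrable (fun z => z ^ k * f z).
Proof.
move=> fi; have bc := bounded1 (@cos_max R); have bs := bounded1 (@sin_max R).
(* Powers are built by repeated multiplication, with [c] the identity for nonnegative [k] and the
   inverse for negative [k]; both have parts cos and +-sin on the circle. *)
have X (c : C -> C) m : (forall g, circle_integrable g ->
    circle_integrable (fun z => c z * g z)) ->
    circle_integrable (fun z => c z ^+ m * f z).
  move=> cP; elim: m => [|m IH].
    by apply: eq_circle_integrable fi => t; rewrite mul1r.
  by apply: eq_circle_integrable (cP _ IH) => t; rewrite mulrA -exprS.
case: k => k; first by apply: (X id) => g; exact: circle_integrable_mul.
apply: (@eq_circle_integrable (fun z => z^-1 ^+ k.+1 * f z)).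
  by move=> t; rewrite exprVn.
have rV : (fun t : R => complex.Re (expi t)^-1) = cos.
  by apply/funext => t; rewrite expiV.
have iV : (fun t : R => complex.Im (expi t)^-1) = (fun t => - sin t).
  by apply/funext => t; rewrite expiV.
apply: X => g; apply: (circle_integrable_mul (c := GRing.inv)); rewrite ?rV ?iV //.
  exact: measurable_funN.
by apply: bounded1 => t; rewrite normrN sin_max.
Qed.

Lemma circle_integrableD f g : circle_integrable f -> circle_integrable g ->
  circle_integrable (fun z => f z + g z).
Proof.
move=> [fr fi] [gr gi]; split.
  by apply: eq_integrable (integrableD mJ fr gr) => // t _ /=; rewrite raddfD.
by apply: eq_integrable (integrableD mJ fi gi) => // t _ /=; rewrite raddfD.
Qed.

Lemma circle_integrable0 : circle_integrable (fun=> 0 : C).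
Proof. by split; exact: integrable0. Qed.

Lemma circle_integralD f g : circle_integrable f -> circle_integrable g ->
  I (fun z => f z + g z) = I f + I g.
Proof.
move=> [fr fi] [gr gi]; rewrite /circle_integral -mulrDr; congr (_ * _).
rewrite -[RHS]/(_ +i* _)%C -!RintegralD //.
by congr (_ +i* _); apply: eq_Rintegral => t _; rewrite raddfD.
Qed.

Lemma circle_integralZ (c : C) f : circle_integrable f ->
  I (fun z => c * f z) = c * I f.
Proof.
move=> [fr fi]; rewrite /circle_integral mulrCA; congr (_ * _).
have intZ (a : R) u : mu.-integrable J (EFin \o u) ->
    mu.-integrable J (EFin \o (fun t => a * u t)).
  by apply: integrable_bounded_mul => //; exact: bounded_cst.
case: c => a b; rewrite -[RHS]/(_ +i* _)%C.
rewrite -!RintegralZl // -RintegralB -?RintegralD //; try exact: intZ.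
congr (_ +i* _); apply: eq_Rintegral => t _ /=; case: (f _) => u v //=.
Qed.

Lemma circle_integral0 : I (fun=> 0) = 0.
Proof.
rewrite -[RHS](mul0r (I (fun=> 0))) -(circle_integralZ 0 circle_integrable0).
by apply: eq_circle_integral => t; rewrite mul0r.
Qed.

Lemma circle_integrable_sum (T : Type) (s : seq T) (F : T -> C -> C) :
  (forall x, circle_integrable (F x)) ->
  circle_integrable (fun z => \sum_(x <- s) F x z).
Proof.
move=> Fi; elim: s => [|x s IH].
  by apply: eq_circle_integrable circle_integrable0 => t; rewrite big_nil.
apply: eq_circle_integrable (circle_integrableD (Fi x) IH) => t.
by rewrite big_cons.
Qed.

Lemma circle_integral_sum (T : Type) (s : seq T) (F : T -> C -> C) :
  (forall x, circle_integrable (F x)) ->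
  I (fun z => \sum_(x <- s) F x z) = \sum_(x <- s) I (F x).
Proof.
move=> Fi; elim: s => [|x s IH].
  rewrite big_nil -[RHS]circle_integral0; apply: eq_circle_integral => t.
  by rewrite big_nil.
rewrite big_cons -IH -circle_integralD //; last exact: circle_integrable_sum.
by apply: eq_circle_integral => t; rewrite big_cons.
Qed.

Lemma circle_integral_n_sum_prod n (T : Type) (s : seq T) (c : T -> C)
    (g : T -> 'I_n -> C -> C) :
  (* Induction on [n]: with the outermost variable fixed, its factor joins the coefficient, the
     induction hypothesis evaluates the inner integral, and linearity evaluates the outer one. *)
  (forall x i, circle_integrable (g x i)) ->
  circle_integral_n (fun z : n.-tuple C =>
     \sum_(x <- s) c x * \prod_(i < n) g x i (tnth z i)) =
  \sum_(x <- s) c x * \prod_(i < n) I (g x i).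
Proof.
elim: n c g => [|n IH] c g gi /=.
  by apply: eq_bigr => x _; rewrite !big_ord0.
transitivity (I (fun z => \sum_(x <- s)
    (c x * \prod_(i < n) I (g x (lift ord0 i))) * g x ord0 z)).
  apply: eq_circle_integral => t.
  transitivity (circle_integral_n (fun z : n.-tuple C => \sum_(x <- s)
     (c x * g x ord0 (expi t)) * \prod_(i < n) g x (lift ord0 i) (tnth z i))).
    congr circle_integral_n; apply/funext => z; apply: eq_bigr => x _.
    rewrite big_ord_recl -mulrA; congr (_ * (_ * _)).
    by apply: eq_bigr => i _; rewrite tnthS.
  rewrite (IH (fun x => c x * g x ord0 (expi t)) (fun x i => g x (lift ord0 i))).
    by apply: eq_bigr => x _; rewrite mulrAC.
  by move=> x i; exact: gi.
rewrite circle_integral_sum => [|x]; last exact: circle_integrableZ.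
apply: eq_bigr => x _; rewrite circle_integralZ //.
by rewrite big_ord_recl mulrAC mulrA.
Qed.

End CircleIntegralTheory.

(** * Andreief's identity and the integral formula for a general kernel *)

Section Kernels.
Local Open Scope classical_set_scope.
Local Open Scope ring_scope.
Variable R : realType.
Local Notation C := R[i].
Local Notation I := (@circle_integral R).
Implicit Types (f a b w : C -> C) (n : nat).

Lemma andreief f a b n :
  (forall j k, circle_integrable (fun z => f z * b z ^+ j * a z ^+ k)) ->
  circle_integral_n (fun z : n.-tuple C => (\prod_(j < n) f (tnth z j)) *
    \prod_(j < n) \prod_(k < n | (j < k)%N)
      ((a (tnth z k) - a (tnth z j)) * (b (tnth z k) - b (tnth z j)))) =
  n`!%:R * \det (\matrix_(j < n, k < n) I (fun z => f z * b z ^+ j * a z ^+ k)).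
Proof.
move=> fi.
pose g (st : 'S_n * 'S_n) (i : 'I_n) z := f z * b z ^+ st.2 i * a z ^+ st.1 i.
transitivity (circle_integral_n (fun z : n.-tuple C => \sum_(st : 'S_n * 'S_n)
    (-1) ^+ st.1 * (-1) ^+ st.2 * \prod_(i < n) g st i (tnth z i))).
  congr circle_integral_n; apply/funext => z.
  rewrite (Vandermonde_prod2 (fun i => a (tnth z i)) (fun i => b (tnth z i))).
  rewrite mulr_sumr; apply: eq_bigr => st _; rewrite mulrCA -big_split /=.
  by congr (_ * _); apply: eq_bigr => i _; rewrite /g; ring.
rewrite (circle_integral_n_sum_prod _
  (fun st : 'S_n * 'S_n => (-1) ^+ st.1 * (-1) ^+ st.2)); last first.
  by move=> st i; exact: fi.
(* The first permutation carries the powers of [a], which index columns here; hence the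
   transpose. *)
rewrite -det_tr -sum_perm2_det; apply: eq_bigr => st _; congr (_ * _).
by apply: eq_bigr => i _; rewrite !mxE.
Qed.

Lemma circle_integral_horner (p : {poly C}) f b n :
  size p = n -> (forall k, circle_integrable (fun z => b z ^+ k * f z)) ->
  I (fun z => p.[b z] * f z) = \sum_(k < n) p`_k * I (fun z => b z ^+ k * f z).
Proof.
move=> ps bf; transitivity (I (fun z => \sum_(k < n) p`_k * (b z ^+ k * f z))).
  apply: eq_circle_integral => t; rewrite horner_coef ps mulr_suml.
  by apply: eq_bigr => k _; rewrite mulrA.
rewrite circle_integral_sum => [|k]; last exact: circle_integrableZ.
by apply: eq_bigr => k _; rewrite circle_integralZ.
Qed.

(** On the circle b^k e_m is a pure power, so the integral conditions are linear in the coefficients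
    of [p], with Fourier coefficients as moments. Solvability ensures that [xget] returns a solution
    and not merely its default 0. *)
Lemma xget_monic_orth w (kappa : nat -> nat -> int) b (e : nat -> C -> C) n :
  circle_integrable w ->
  (forall m k t, b (expi t) ^+ k * e m (expi t) = expi t ^ (- kappa m k)) ->
  \det (moment_mx (fun m k => fourier w (kappa m k)) n) != 0 ->
  monic_orth (fun m k => fourier w (kappa m k)) n
    (xget 0 [set p : {poly C} | monic_deg n p /\
      forall m, (m < n)%N -> I (fun z => p.[b z] * e m z * w z) = 0]).
Proof.
move=> wi be M0.
have IE (p : {poly C}) m : size p = n.+1 -> I (fun z => p.[b z] * e m z * w z) =
    \sum_(k < n.+1) p`_k * fourier w (kappa m k).
  move=> ps; under [fun z => _]eq_fun => z do rewrite -mulrA.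
  have bE k t : expi t ^ (- kappa m k) * w (expi t) =
      b (expi t) ^+ k * (e m (expi t) * w (expi t)) by rewrite mulrA be.
  rewrite (circle_integral_horner ps) => [|k].
    by apply: eq_bigr => k _; congr (_ * _); apply: eq_circle_integral => t.
  exact: eq_circle_integrable (bE k) (circle_integrable_exprz _ wi).
set S := (X in xget 0 X); suff [pd po] : S (xget 0 S).
  by split=> // m mn; rewrite -IE ?po //; case: pd.
apply: xgetPex; have [p [pd po]] := monic_orth_exists M0; exists p.
by split=> // m mn; rewrite IE ?po //; case: pd.
Qed.

(** Multiplying the weight by (x - b)(y - a) combines each moment with its neighbours in row and
    column. This produces exactly the matrix of [det_shift_moment], so the determinant from
    Andreief's identity is det M times the kernel. *)
Lemma kernel_integral w (kappa : nat -> nat -> int) (e : int) a b n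
    (P Q : nat -> {poly C}) (x y : C) :
  circle_integrable w ->
  (forall j k t, expi t ^ e * a (expi t) ^+ j * b (expi t) ^+ k =
     expi t ^ (- kappa j k)) ->
  let M j k := fourier w (kappa j k) in
  (forall m, (m <= n.+1)%N -> \det (moment_mx M m) != 0) ->
  (forall i, (i < n.+1)%N -> monic_orth M i (P i)) ->
  (forall i, (i < n.+1)%N -> monic_orth (fun j k => M k j) i (Q i)) ->
  \sum_(i < n.+1) (\det (moment_mx M i.+1) / \det (moment_mx M i))^-1
                   * (Q i).[y] * (P i).[x] =
  (\det (moment_mx M n.+1))^-1 * (n`!%:R^-1 *
    circle_integral_n (fun z : n.-tuple C =>
      (\prod_(j < n) (w (tnth z j) * tnth z j ^ e * (x - b (tnth z j))
                      * (y - a (tnth z j)))) *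
      \prod_(j < n) \prod_(k < n | (j < k)%N)
        ((b (tnth z k) - b (tnth z j)) * (a (tnth z k) - a (tnth z j))))).
Proof.
move=> wi ab M M0 Po Qo; rewrite (biorth_kernel _ _ M0 Po Qo).
pose X j k (z : C) := z ^ (- kappa j k) * w z.
have Xi j k : circle_integrable (X j k) by exact: circle_integrable_exprz.
pose f z := w z * z ^ e * (x - b z) * (y - a z).
(* The two linear factors are expanded into four monomials, each a pure power times [w] on the
   circle. *)
have fE j k t : (y * x) * X j k (expi t) + (- y) * X j k.+1 (expi t) +
    ((- x) * X j.+1 k (expi t) + X j.+1 k.+1 (expi t)) =
    f (expi t) * a (expi t) ^+ j * b (expi t) ^+ k.
  by rewrite /X -!ab /f !exprS; ring.
have Z c j k := circle_integrableZ c (Xi j k).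
have fi j k : circle_integrable (fun z => f z * a z ^+ j * b z ^+ k).
  apply: eq_circle_integrable (fE j k) _.
  exact: circle_integrableD (circle_integrableD (Z (y * x) j k) (Z (- y) j k.+1))
                            (circle_integrableD (Z (- x) j.+1 k) (Xi j.+1 k.+1)).
(* Here [a] and [b] exchange roles, so rows carry powers of [a]; the factorials cancel. *)
rewrite (andreief (f := f)) // mulKf ?pnatr_eq0 -?lt0n ?fact_gt0 //.
rewrite (_ : \matrix_(j, k) _ = \matrix_(j < n, k < n)
     (y * (x * M j k - M j k.+1) - (x * M j.+1 k - M j.+1 k.+1))).
  by rewrite det_shift_moment ?M0 // mulKf ?M0.
apply/matrixP => j k; rewrite !mxE.
transitivity (I (fun z => ((y * x) * X j k z + (- y) * X j k.+1 z) +
                          ((- x) * X j.+1 k z + X j.+1 k.+1 z))).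
  by apply: eq_circle_integral => t; rewrite fE.
rewrite (circle_integralD (circle_integrableD (Z (y * x) j k) (Z (- y) j k.+1))
                          (circle_integrableD (Z (- x) j.+1 k) (Xi j.+1 k.+1))).
rewrite (circle_integralD (Z (y * x) j k) (Z (- y) j k.+1)).
rewrite (circle_integralD (Z (- x) j.+1 k) (Xi j.+1 k.+1)).
by rewrite !(circle_integralZ _ (Xi _ _)) /M /fourier -/(X _ _); ring.
Qed.

(** * Specialisation to the moments of the D and E determinants *)

Lemma momentD_exponent (r : int) (j k : nat) (z : C) : z != 0 ->
  z ^ (- r) * (z ^- 2) ^+ j * z ^+ k = z ^ (- (r + 2 * j%:Z - k%:Z)).
Proof.
move=> z0; rewrite exprnN !exprnP exprz_exp -!expfzDr //; congr (_ ^ _); ring.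
Qed.

Lemma momentE_exponent (s : int) (j k : nat) (z : C) : z != 0 ->
  z ^ (- s) * z^-1 ^+ j * (z ^+ 2) ^+ k = z ^ (- (s + j%:Z - 2 * k%:Z)).
Proof.
move=> z0; rewrite -exprN1 !exprnP !exprz_exp -!expfzDr //; congr (_ ^ _); ring.
Qed.

Lemma polyP_orth w n (r : int) : circle_integrable w -> detD w n r != 0 ->
  monic_orth (fun j k => fourier w (r + 2 * j%:Z - k%:Z)) n (Defs.polyP w n r).
Proof.
move=> wi D0; apply: (xget_monic_orth (b := id)
  (e := fun m z => z ^ (- (2 * m%:Z) - r))) => // m k t.
rewrite exprnP -expfzDr ?expi_neq0 //; congr (_ ^ _); ring.
Qed.

(** Powers of z^-2 now index the columns, so the moment matrix is the transpose of that of [detD]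
    and has the same determinant. *)
Lemma polyQ_orth w n (r : int) : circle_integrable w -> detD w n r != 0 ->
  monic_orth (fun j k => fourier w (r + 2 * k%:Z - j%:Z)) n (polyQ w n r).
Proof.
move=> wi D0; apply: (xget_monic_orth (b := fun z => z ^- 2)
  (e := fun m z => z ^ (m%:Z - r))) => // [m k t|].
  rewrite exprnN exprnP exprz_exp -expfzDr ?expi_neq0 //; congr (_ ^ _); ring.
rewrite -det_tr; congr (\det _ != 0): D0.
by apply/matrixP => j k; rewrite !mxE.
Qed.

Lemma polyR_orth w n (s : int) : circle_integrable w -> detE w n s != 0 ->
  monic_orth (fun j k => fourier w (s + j%:Z - 2 * k%:Z)) n (polyR w n s).
Proof.
move=> wi D0; apply: (xget_monic_orth (b := fun z => z ^+ 2)
  (e := fun m z => z ^ (- m%:Z - s))) => // m k t.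
rewrite !exprnP exprz_exp -expfzDr ?expi_neq0 //; congr (_ ^ _); ring.
Qed.

Lemma polyS_orth w n (s : int) : circle_integrable w -> detE w n s != 0 ->
  monic_orth (fun j k => fourier w (s + k%:Z - 2 * j%:Z)) n (polyS w n s).
Proof.
move=> wi D0; apply: (xget_monic_orth (b := fun z => z^-1)
  (e := fun m z => z ^ (2 * m%:Z - s))) => // [m k t|].
  rewrite -exprN1 exprnP exprz_exp -expfzDr ?expi_neq0 //; congr (_ ^ _); ring.
rewrite -det_tr; congr (\det _ != 0): D0.
by apply/matrixP => j k; rewrite !mxE.
Qed.

Lemma kerK_sum w n (z y : C) (r : int) : circle_integrable w ->
  (forall m, (m <= n.+1)%N -> detD w m r != 0) ->
  kerK w n z y r = \sum_(j < n.+1) \sum_(k < n.+1) z ^+ j * y ^+ k *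
    invmx (moment_mx (fun j k => fourier w (r + 2 * j%:Z - k%:Z)) n.+1) k j.
Proof.
move=> wi D0.
by rewrite -(biorth_kernel z y D0 (P := Defs.polyP w ^~ r) (Q := polyQ w ^~ r)) //
  => i /ltnW/D0;
  [exact: polyP_orth | exact: polyQ_orth].
Qed.

Lemma kerL_sum w n (z y : C) (s : int) : circle_integrable w ->
  (forall m, (m <= n.+1)%N -> detE w m s != 0) ->
  kerL w n z y s = \sum_(j < n.+1) \sum_(k < n.+1) z ^+ j * y ^+ k *
    invmx (moment_mx (fun j k => fourier w (s + j%:Z - 2 * k%:Z)) n.+1) k j.
Proof.
move=> wi E0.
by rewrite -(biorth_kernel z y E0 (P := polyR w ^~ s) (Q := polyS w ^~ s)) //
  => i /ltnW/E0;
  [exact: polyR_orth | exact: polyS_orth].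
Qed.

End Kernels.

(** * The two integral formulas and the reflection relating the two kernels *)

Theorem theorem5p5 (R : realType) (w : R[i] -> R[i])
    (hw : circle_integrable w) (n : nat) (hn : (1 <= n)%N) (r s : int) :
  ((forall m : nat, (1 <= m <= n.+1)%N -> detD w m r != 0) ->
    forall z1 z2 : R[i],
      kerK w n z2 z1 r =
      (detD w n.+1 r)^-1 *
        calD n (fun z => w z * z ^ (- r) * (z1 - z) * (z2 - z ^- 2)))
  /\
  ((forall m : nat, (1 <= m <= n.+1)%N -> detE w m s != 0) ->
    (forall z1 z2 : R[i],
      kerL w n z2 z1 s =
      (detE w n.+1 s)^-1 *
        calE n (fun z => w z * z ^ (- s) * (z1 - z ^+ 2) * (z2 - z^-1)))
    /\
    ((forall m : nat, (1 <= m <= n.+1)%N -> detD w m (s - n%:Z) != 0) ->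
      forall z1 z2 : R[i], z1 != 0 -> z2 != 0 ->
        kerL w n z2 z1 s =
        (z1 * z2) ^+ n * kerK w n z1^-1 z2^-1 (s - n%:Z))).
Proof.
(* The empty determinant is 1, which extends nonvanishing to m = 0, the denominator of the first
   norm. *)
have D0 t : (forall m, (1 <= m <= n.+1)%N -> detD w m t != 0) ->
    forall m, (m <= n.+1)%N -> detD w m t != 0.
  by move=> h [_|m mn]; [rewrite /detD det_mx00 oner_neq0|exact: h].
have E0 t : (forall m, (1 <= m <= n.+1)%N -> detE w m t != 0) ->
    forall m, (m <= n.+1)%N -> detE w m t != 0.
  by move=> h [_|m mn]; [rewrite /detE det_mx00 oner_neq0|exact: h].
split=> [/D0 Dr z1 z2|/E0 Es].
  apply: (@kernel_integral _ w (fun j k => r + 2 * j%:Z - k%:Z) (- r)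
    (fun z => z ^- 2) id n (Defs.polyP w ^~ r) (polyQ w ^~ r)) => //.
  - by move=> j k t; rewrite momentD_exponent ?expi_neq0.
  - by move=> i /ltnW/Dr; exact: polyP_orth.
  - by move=> i /ltnW/Dr; exact: polyQ_orth.
split=> [z1 z2|/D0 Ds z1 z2 z10 z20].
  apply: (@kernel_integral _ w (fun j k => s + j%:Z - 2 * k%:Z) (- s)
    (fun z => z^-1) (fun z => z ^+ 2) n (polyR w ^~ s) (polyS w ^~ s)) => //.
  - by move=> j k t; rewrite momentE_exponent ?expi_neq0.
  - by move=> i /ltnW/Es; exact: polyR_orth.
  - by move=> i /ltnW/Es; exact: polyS_orth.
rewrite kerL_sum // kerK_sum // exchange_big mulr_sumr.
(* Reversing both indices turns z1^k z2^j into z1^(n-k) z2^(n-j), which is (z1 z2)^n times powers of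
   the inverses. *)
rewrite (reindex_inj rev_ord_inj); apply: eq_bigr => k _.
rewrite mulr_sumr (reindex_inj rev_ord_inj); apply: eq_bigr => j _.
rewrite (invmx_moment_rev (M' := fun j k => fourier w (s - n%:Z + 2 * j%:Z - k%:Z))).
- rewrite !rev_ordK mulrA; congr (_ * _) => /=.
  rewrite !subSS !expfB_cond ?(negbTE z10) ?(negbTE z20) ?leq_ord //.
  by rewrite !exprVn exprMn [RHS]mulrACA mulrC.
(* The Fourier indices agree: (s - n) + 2(n - b) - (n - a) = s + a - 2b. *)
- move=> a b an bn; congr fourier; rewrite -!subzn //; ring.
- exact: Ds.
Qed.
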